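(* Let $N\ge 3$ be an integer. Given $\alpha>1/2$, there exists $c=c(\alpha)>0$ such that for every measurable function $u:\mathbb{R}^N\to\mathbb{R}$, $$\int_{\mathbb{R}^N}\int_{\mathbb{R}^N}\frac{u^2(x)\,u^2(y)}{|x-y|^{N-2}}\,dx\,dy\;\ge\; c\left(\int_{\mathbb{R}^N}\frac{u(x)^2}{|x|^{\frac{N-2}{2}}\,(1+|\log|x||)^{\alpha}}\,dx\right)^2 .$$ In particular, for every $\alpha>1/2$, $E(\mathbb{R}^3)\subset L^2\big(\mathbb{R}^3,\ |x|^{-\frac12}(1+|\log|x||)^{-\alpha}\,dx\big)$ with continuous inclusion.
   Context: Integrals of nonnegative functions take values in $[0,+\infty]$. $D^{1,2}(\mathbb{R}^3)=\{u\in L^{6}(\mathbb{R}^3):\ |\nabla u|\in L^2(\mathbb{R}^3)\}$. The space $E(\mathbb{R}^3)$ is the set of $u\in D^{1,2}(\mathbb{R}^3)$ with $\int_{\mathbb{R}^3}\int_{\mathbb{R}^3}\frac{u^2(x)u^2(y)}{|x-y|}\,dx\,dy<+\infty$, with the norm $$\|u\|_E=\left(\int_{\mathbb{R}^3}|\nabla u|^2\,dx+\Big(\int_{\mathbb{R}^3}\int_{\mathbb{R}^3}\frac{u^2(x)u^2(y)}{|x-y|}\,dx\,dy\Big)^{1/2}\right)^{1/2}.$$ $L^2(\mathbb{R}^3,w\,dx)$ denotes the weighted space with norm $(\int u^2 w\,dx)^{1/2}$. *)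

(* Defs.v *)
From HB Require Import structures.
From mathcomp Require Import all_boot all_order all_algebra.
From mathcomp Require Import all_classical all_reals all_analysis.
From mathcomp Require Import measurable_realfun.

Set Implicit Arguments.
Unset Strict Implicit.
Unset Printing Implicit Defensive.
Import Order.TTheory GRing.Theory Num.Theory.
Import numFieldTopology.Exports numFieldNormedType.Exports.

Local Open Scope classical_set_scope.
Local Open Scope ring_scope.

(* R^n is 'rV[R]_n, with the Borel sigma-algebra, generated by the            *)
(* coordinate functions.                                                      *)
Section measurable_rV.
Context {R : realType} (n : nat).

Definition rV_coord (i : 'I_n) (x : 'rV[R]_n) : measurableTypeR R := x ord0 i.

Let rV_set0 : g_sigma_preimage rV_coord set0.
Proof. exact: sigma_algebra0. Qed.

Let rV_setC A : g_sigma_preimage rV_coord A -> g_sigma_preimage rV_coord (~` A).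
Proof. exact: sigma_algebraC. Qed.

Let rV_bigcup (F : _^nat) : (forall i, g_sigma_preimage rV_coord (F i)) ->
  g_sigma_preimage rV_coord (\bigcup_i (F i)).
Proof. exact: sigma_algebra_bigcup. Qed.

HB.instance Definition _ := @isMeasurable.Build default_measure_display
  'rV[R]_n (g_sigma_preimage rV_coord) rV_set0 rV_setC rV_bigcup.

End measurable_rV.
Arguments rV_coord {R n} i x.

Section lebesgue_rV.
Context {R : realType}.

Lemma measurable_rV_coord n (i : 'I_n) :
  measurable_fun [set: 'rV[R]_n] (rV_coord i).
Proof.
move=> _ Y mY; rewrite setTI; apply: sub_sigma_algebra => /=.
rewrite -bigcup_seq/=; exists i => /=; first by rewrite mem_index_enum.
by exists Y => //; rewrite setTI.
Qed.

Lemma measurable_fun_rVP d (T : measurableType d) n (f : T -> 'rV[R]_n) :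
  (forall i, measurable_fun [set: T] (rV_coord i \o f)) ->
  measurable_fun [set: T] f.
Proof.
move=> mf.
suff prefS : g_sigma_preimage (fun i => rV_coord i \o f) `<=` measurable.
  move=> _ A mA; apply: prefS; rewrite g_sigma_preimage_comp.
  by exists A.
apply: smallest_sub; first exact: sigma_algebra_measurable.
case: n => [|n] in f mf *; first by rewrite big_ord0.
rewrite -bigcup_mkord_ord; apply: bigcup_sub => i Ii.
by move=> A [B mB <-]; exact: mf.
Qed.

Definition rV_cons n (p : measurableTypeR R * 'rV[R]_n) : 'rV[R]_n.+1 :=
  \row_i (if unlift ord0 i is Some j then p.2 ord0 j else p.1).

Definition rV_uncons n (x : 'rV[R]_n.+1) : measurableTypeR R * 'rV[R]_n :=
  (x ord0 ord0, \row_j x ord0 (lift ord0 j)).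

Lemma rV_consK n : cancel (@rV_cons n) (@rV_uncons n).
Proof.
case=> a x; rewrite /rV_uncons /rV_cons; congr pair.
  by rewrite mxE unlift_none.
by apply/rowP => j; rewrite !mxE liftK.
Qed.

Lemma measurable_rV_cons n : measurable_fun setT (@rV_cons n).
Proof.
apply: measurable_fun_rVP => i; rewrite /comp /rV_coord.
under eq_fun do rewrite mxE.
case: unliftP => [j _|_]; last exact: measurable_fst.
apply: (@measurableT_comp _ _ _ _ _ _ (rV_coord j) _ snd) => //.
exact: measurable_rV_coord.
Qed.

Lemma measurable_rV_uncons n : measurable_fun setT (@rV_uncons n).
Proof.
apply/measurable_fun_pairP; split; first exact: (measurable_rV_coord ord0).
apply: measurable_fun_rVP => i; rewrite /comp /rV_coord.
under eq_fun do rewrite mxE.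
exact: (measurable_rV_coord (lift ord0 i)).
Qed.

Section lebesgue_rVS.
Variables (n : nat) (m : {sigma_finite_measure set 'rV[R]_n -> \bar R}).

Definition lebesgue_rVS : set 'rV[R]_n.+1 -> \bar R :=
  pushforward (lebesgue_measure \x m)%E (@rV_cons n).

Let lebesgue_rVS0 : lebesgue_rVS set0 = 0%E.
Proof. by rewrite /lebesgue_rVS /pushforward preimage_set0 measure0. Qed.

Let lebesgue_rVS_ge0 A : (0 <= lebesgue_rVS A)%E.
Proof. by rewrite /lebesgue_rVS /pushforward. Qed.

Let lebesgue_rVS_sigma_additive : semi_sigma_additive lebesgue_rVS.
Proof.
move=> F mF tF mUF; rewrite /lebesgue_rVS /pushforward preimage_bigcup.
apply: measure_semi_sigma_additive.
- by move=> k; rewrite -[X in measurable X]setTI; exact: measurable_rV_cons.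
- apply/trivIsetP => /= i j _ _ ij; rewrite -preimage_setI.
  by move/trivIsetP : tF => /(_ _ _ _ _ ij) ->//; rewrite preimage_set0.
- rewrite -preimage_bigcup -[X in measurable X]setTI.
  exact: measurable_rV_cons.
Qed.

HB.instance Definition _ := isMeasure.Build _ _ _ lebesgue_rVS
  lebesgue_rVS0 lebesgue_rVS_ge0 lebesgue_rVS_sigma_additive.

Let lebesgue_rVS_sigma_finite : sigma_finite setT lebesgue_rVS.
Proof.
have /sigma_finiteP[F [TF ndF Foo]] :=
  sigma_finiteT (@lebesgue_measure R : {sigma_finite_measure set _ -> \bar R}).
have /sigma_finiteP[G [TG ndG Goo]] := sigma_finiteT m.
exists (fun k => @rV_uncons n @^-1` (F k `*` G k)).
  rewrite -preimage_bigcup (_ : \bigcup_k _ = setT) ?preimage_setT//.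
  apply/seteqP; split => // -[x y] _.
  have [i _ Fx] : (\bigcup_i F i) x by rewrite -TF.
  have [j _ Gy] : (\bigcup_j G j) y by rewrite -TG.
  exists (maxn i j) => //; split => /=.
  - by move: x Fx; exact/subsetPset/ndF/leq_maxl.
  - by move: y Gy; exact/subsetPset/ndG/leq_maxr.
move=> k; have [mFk Fkoo] := Foo k; have [mGk Gkoo] := Goo k; split.
  rewrite -[X in measurable X]setTI; apply: measurable_rV_uncons => //.
  exact: measurableX.
rewrite /lebesgue_rVS /pushforward -comp_preimage.
rewrite (_ : _ \o _ = id) ?preimage_id; last exact/funext/rV_consK.
by rewrite product_measure1E// lte_mul_pinfty// ge0_fin_numE.
Qed.

HB.instance Definition _ := Measure_isSigmaFinite.Build _ _ _ lebesgue_rVS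
  lebesgue_rVS_sigma_finite.

End lebesgue_rVS.

(* Lebesgue measure on R^n, on the Borel sets, as an iterated product.        *)
Fixpoint lebesgue_rV n : {sigma_finite_measure set 'rV[R]_n -> \bar R} :=
  match n return {sigma_finite_measure set 'rV[R]_n -> \bar R} with
  | 0%N => @dirac _ 'rV[R]_0 0 R
  | n'.+1 => lebesgue_rVS (lebesgue_rV n')
  end.

Lemma lebesgue_rV_box n (A : 'I_n -> set (measurableTypeR R)) :
  (forall i, measurable (A i)) ->
  lebesgue_rV n [set x | forall i, A i (x ord0 i)] =
  (\prod_(i < n) lebesgue_measure (A i))%E.
Proof.
elim: n A => [A _|n IH A mA].
  rewrite big_ord0 /= diracE mem_set//; by case.
pose B : set 'rV[R]_n := [set x | forall i, A (lift ord0 i) (x ord0 i)].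
have mB : measurable B.
  rewrite (_ : B = \bigcap_(i in [set: 'I_n])
      (setT `&` rV_coord i @^-1` A (lift ord0 i))).
    by apply: fin_bigcap_measurable => // i _; exact: measurable_rV_coord.
  by apply/seteqP; split => x /= Ax i; [move=> _; split|have [] := Ax i I].
have consE : @rV_cons n @^-1` [set x | forall i, A i (x ord0 i)] = A ord0 `*` B.
  apply/seteqP; split => -[a x] /=.
    move=> Ax; split; first by have := Ax ord0; rewrite mxE unlift_none.
    by move=> i; have := Ax (lift ord0 i); rewrite mxE liftK.
  by move=> [Aa Ax] i; rewrite mxE; case: unliftP => [j ->|->] //; exact: Ax.
by rewrite big_ord_recl -IH// -product_measure1E//= -consE.
Qed.

End lebesgue_rV.

Section weighted_L2.
Context {R : realType} {n : nat}.
Implicit Types (x : 'rV[R]_n) (u w : 'rV[R]_n -> R).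

Local Notation mu := (@lebesgue_rV R n).

(* Measurability for the completion of mu. The integrals below are taken      *)
(* against mu itself: \int[mu] is a supremum over Borel simple functions, and *)
(* on nonnegative functions measurable for the completion it has the same     *)
(* value as the integral against the completed measure.                       *)
Definition lebesgue_measurable u : Prop :=
  forall B : set R, measurable B -> completed_algebra_gen mu (u @^-1` B).

(* The norm `|x| of 'rV[R]_n is the sup norm.                                 *)
Definition enorm x : R := Num.sqrt (\sum_(i < n) x ord0 i ^+ 2).

Definition weighted_L2norm w u : \bar R :=
  ((\int[mu]_x (u x ^+ 2 * w x)%:E) `^ 2^-1)%E.

Definition weighted_L2 w : set ('rV[R]_n -> R) :=
  [set u | lebesgue_measurable u /\ (weighted_L2norm w u < +oo)%E].

End weighted_L2.

Section weak_gradient.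
Context {R : realType} {n : nat}.
Implicit Types (u phi : 'rV[R]_n -> R) (g : 'rV[R]_n -> 'rV[R]_n).

Local Notation mu := (@lebesgue_rV R n).

Definition partial (i : 'I_n) phi : 'rV[R]_n -> R :=
  fun x => 'D_(delta_mx ord0 i) phi x.

Fixpoint Ck (k : nat) phi : Prop :=
  if k is k'.+1 then
    continuous phi /\
    forall i, (forall x, derivable phi x (delta_mx ord0 i)) /\
              Ck k' (partial i phi)
  else continuous phi.

Definition test_function phi : Prop :=
  (forall k, Ck k phi) /\ compact (closure [set x | phi x != 0]).

Definition locally_integrable_rV u : Prop :=
  lebesgue_measurable u /\
  forall K : set 'rV[R]_n, compact K -> (\int[mu]_(x in K) `|u x|%:E < +oo)%E.

Definition is_weak_gradient u g : Prop :=
  [/\ locally_integrable_rV u,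
      forall i, locally_integrable_rV (fun x => g x ord0 i) &
      forall phi, test_function phi -> forall i,
        (\int[mu]_x (u x * partial i phi x)%:E =
         - \int[mu]_x (g x ord0 i * phi x)%:E)%E ].

(* Weak gradients are unique up to a null set.                                *)
Definition weak_gradient u : 'rV[R]_n -> 'rV[R]_n :=
  xget (fun=> 0) [set g | is_weak_gradient u g].

End weak_gradient.

Section coulomb_sobolev.
Context {R : realType}.
Implicit Types u : 'rV[R]_3 -> R.

Local Notation mu := (@lebesgue_rV R 3).

(* On the null set x = y, where the kernel is infinite, division by 0 makes   *)
(* the integrand 0.                                                           *)
Definition coulomb u : \bar R :=
  (\int[mu]_x \int[mu]_y (u x ^+ 2 * u y ^+ 2 / enorm (x - y))%:E)%E.

(* Elements are functions, not classes modulo almost everywhere equality.     *)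
Definition D12 : set ('rV[R]_3 -> R) :=
  [set u | [/\ lebesgue_measurable u, finite_norm mu 6%:E u,
               exists g, is_weak_gradient u g &
               finite_norm mu 2%:E (@enorm R 3 \o weak_gradient u)]].

Definition E_space : set ('rV[R]_3 -> R) :=
  [set u | D12 u /\ (coulomb u < +oo)%E].

Definition E_norm u : \bar R :=
  ((\int[mu]_x (enorm (weak_gradient u x) ^+ 2)%:E + coulomb u `^ 2^-1)
     `^ 2^-1)%E.

End coulomb_sobolev.

(* X and Y are sets of functions with norms NX and NY, which take values in   *)
(* the extended reals. The inclusion being linear, its continuity also        *)
(* amounts to the last clause.                                                *)
Definition continuous_inclusion (R : realType) (T : Type)
    (X : set (T -> R)) (NX : (T -> R) -> \bar R)
    (Y : set (T -> R)) (NY : (T -> R) -> \bar R) : Prop :=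
  [/\ X `<=` Y,
      forall u, X u -> forall eps : R, 0 < eps ->
        exists2 delta : R, 0 < delta &
          forall v, X v -> (NX (v \- u)%R < delta%:E)%E ->
            (NY (v \- u)%R < eps%:E)%E &
      exists2 C : R, 0 < C & forall u, X u -> (NY u <= C%:E * NX u)%E].

(* Main.v *)
Require Import Defs.
From HB Require Import structures.
From mathcomp Require Import all_boot all_order all_algebra.
From mathcomp Require Import all_classical all_reals all_analysis.
From mathcomp Require Import measurable_realfun ring lra.
Import Order.TTheory GRing.Theory Num.Theory.
Import numFieldTopology.Exports numFieldNormedType.Exports.
Local Open Scope classical_set_scope.
Local Open Scope ring_scope.

(** The kernel is bounded below through |x - y|^2 <= 2 (|x|^2 + |y|^2). Cut
    R^N into the logarithmic shells B_k = {k <= log|x| < k + 1}, k an integer,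
    and put p = (N - 2) / 2. Two points of the same shell have comparable
    norms, so that |x - y|^(N-2) <= (4 e)^p |x|^p |y|^p there
    (enormB_log_shell_le). Dropping the pairs of points in different shells,
    the double integral is at least (4 e)^(-p) times the sum of the a_k^2,
    where a_k is the integral over B_k of u^2 / |x|^p. The weight (1 +
    |log|x||)^(-alpha) is at most a multiple of (1 + |k|)^(-alpha) on B_k, so
    the weighted integral is at most a multiple of the sum of the (1 +
    |k|)^(-alpha) a_k, and the Cauchy-Schwarz inequality concludes because the
    sum of the (1 + |k|)^(-2 alpha) converges exactly when alpha > 1/2. Lemma
    sqr_integral_le_layer_energy carries out this comparison on any measure
    space cut into countably many layers.

    Two measure-theoretic points need care. The integrand vanishes on the
    diagonal, where the true kernel is infinite; points have measure zero, so
    each inner integral may omit one point. Moreover u is measurable only for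
    the completed sigma-algebra, and the integrals are lower integrals of
    functions that need not be Borel. Lower integrals are monotone on all
    nonnegative functions (ge0_le_lower_integral), so it suffices to bound the
    two sides of the inequality by integrals built from a Borel function that
    equals u off a null set (completion_measurable_ae_borel).

    For N = 3 the inequality bounds the weighted L^2 norm of u by a multiple
    of the fourth root of its Coulomb energy, hence of its norm in E. This
    holds for every function with a Borel version, in particular for the
    difference of two elements of E, which gives the continuity of the
    inclusion. *)

(** * Lower integrals and Borel versions *)

(** The integral of a nonnegative function is a supremum over the simple
    functions below it, hence monotone even when neither function is
    measurable. *)
Lemma ge0_le_lower_integral d (T : measurableType d) (R : realType)
    (mu : {measure set T -> \bar R}) (f g : T -> \bar R) :
  (forall x, 0 <= f x)%E -> (forall x, f x <= g x)%E ->
  (\int[mu]_x f x <= \int[mu]_x g x)%E.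
Proof.
move=> f0 fg; have g0 x : (0 <= g x)%E by exact: le_trans (f0 x) (fg x).
rewrite !ge0_integralTE//; apply: le_ereal_sup => _ [h hf <-].
by exists h => // x; exact: le_trans (hf x) (fg x).
Qed.

(** The exceptional set is required to be measurable, so that v can be
    redefined on it without losing measurability. *)
Definition ae_borel {d} {T : measurableType d} {R : realType}
    (mu : set T -> \bar R) (u : T -> R) :=
  exists A (v : T -> R), [/\ measurable A, mu A = 0%E,
    measurable_fun [set: T] v & forall x, ~ A x -> u x = v x].

(** For each rational q the set {u > q} is a Borel set up to a null set. Off
    the countable union A of these null sets, every {u > q} is Borel, and the
    rational rays determine u; setting u to 0 on A gives a Borel function. *)
Lemma completion_measurable_ae_borel d (T : measurableType d) (R : realType)
    (mu : {measure set T -> \bar R}) (u : T -> R) :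
  (forall B : set R, measurable B -> completed_algebra_gen mu (u @^-1` B)) ->
  ae_borel mu u.
Proof.
move=> mu_u.
have ray (q : rat) : exists BA : set T * set T,
    [/\ measurable BA.1, measurable BA.2, mu BA.2 = 0%E &
        forall x, ~ BA.2 x -> (u x > ratr q) <-> BA.1 x].
  have [B mB [N [A [mA A0 NA]] BNu]] :=
    mu_u `]ratr q, +oo[%classic (measurable_itv _).
  exists (B, A); split=> //= x nAx.
  have -> : (ratr q < u x) = (u @^-1` `]ratr q, +oo[%classic) x :> Prop.
    by rewrite /= in_itv/= andbT.
  by rewrite -BNu; split=> [[//|/NA//]|]; left.
have [BA BAP] := choice ray.
(* The rationals are enumerated by nat, with 0 for the numbers that code
   nothing. *)
pose A := \bigcup_n (BA (odflt 0 (unpickle n))).2.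
have mA : measurable A.
  by apply: bigcupT_measurable => n; have [] := BAP (odflt 0 (unpickle n)).
have subA q x : (BA q).2 x -> A x by exists (pickle q); rewrite //= pickleK.
exists A, (u \_ (~` A)); split=> //.
- apply/(negligibleP mu mA)/negligible_bigcup => n.
  have [_ mAn An0 _] := BAP (odflt 0 (unpickle n)).
  exact/negligibleP.
- move=> mT; apply: (measurability _ (RGenOInfty.measurableE R)) => //.
  move=> _ [_ [a ->] <-]; rewrite preimage_itvoy setTI.
  (* On A the function is 0, so A lies inside {v > a} exactly when a < 0. *)
  rewrite (_ : [set x | _] =
      ((\bigcup_(q in [set q : rat | a < ratr q]) (BA q).1) `\` A) `|`
      (if a < 0 then A else set0)).
    apply: measurableU; last by case: ifP.
    apply: measurableD => //; rewrite bigcup_mkcond.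
    apply: bigcupT_measurable_rat => q.
    by case: ifP => // _; have [] := BAP q.
  apply/seteqP; split=> x /=; rewrite patchE.
  - case: ifPn => [|/negP xA].
      rewrite inE => nAx /rat_in_itvoo[q /itvP aqu]; left; split=> //.
      have [_ _ _ /(_ x)[]] := BAP q; first by move/subA.
      by move=> + _; rewrite aqu => /(_ isT) ?; exists q => //=; rewrite aqu.
    rewrite /point/= => a0; right; rewrite a0.
    by apply: contrapT => nAx; apply: xA; rewrite inE.
  - move=> [[[q /= aq Bqx] nAx]|].
      rewrite mem_set//; have [_ _ _ /(_ x)[]] := BAP q.
        by move/subA.
      by move=> _ /(_ Bqx); apply: lt_trans.
    case: ifPn => // a0 Ax; case: ifPn => // /set_mem; exact.
- by move=> x nAx; rewrite patchE mem_set.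
Qed.

Lemma ae_borelB d (T : measurableType d) (R : realType)
    (mu : {measure set T -> \bar R}) (u1 u2 : T -> R) :
  ae_borel mu u1 -> ae_borel mu u2 -> ae_borel mu (u1 \- u2).
Proof.
move=> [A1 [v1 [mA1 A10 mv1 uv1]]] [A2 [v2 [mA2 A20 mv2 uv2]]].
exists (A1 `|` A2), (v1 \- v2); split.
- exact: measurableU.
- apply/negligibleP; first exact: measurableU.
  by apply: negligibleU; exact/negligibleP.
- exact: measurable_funB.
- by move=> x /not_orP[n1 n2] /=; rewrite uv1// uv2.
Qed.

(** * Sums over layers *)

(** Summing 2 b a <= t a^2 + b^2 / t gives 2 T <= t S + Q / t for every t > 0,
    where T is the sum of the b a and S that of the a^2. This form passes to
    the limit and tolerates infinite terms. *)
Lemma cauchy_schwarz_nneseries (R : realType) (a : nat -> \bar R) (b : nat -> R)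
    (Q : R) : 0 < Q -> (forall n, 0 <= a n)%E -> (forall n, 0 <= b n) ->
  (\sum_(n <oo) (b n ^+ 2)%:E <= Q%:E)%E ->
  ((\sum_(n <oo) (b n)%:E * a n) ^+ 2 <= Q%:E * \sum_(n <oo) a n ^+ 2)%E.
Proof.
move=> Q0 a0 b0 bQ.
have a20 n : (0 <= a n ^+ 2)%E by rewrite expe2 mule_ge0.
have ba0 n : (0 <= (b n)%:E * a n)%E by rewrite mule_ge0// lee_fin.
set T := (\sum_(n <oo) (b n)%:E * a n)%E; set S := (\sum_(n <oo) a n ^+ 2)%E.
have T0 : (0 <= T)%E by apply: nneseries_ge0 => n _ _; exact: ba0.
have S0 : (0 <= S)%E by apply: nneseries_ge0 => n _ _; exact: a20.
have amgm (t : R) : 0 < t -> (2%:E * T <= t%:E * S + (t^-1 * Q)%:E)%E.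
  move=> t0; have it0 : 0 < t^-1 by rewrite invr_gt0.
  rewrite -nneseriesZl//.
  apply: (@le_trans _ _
      (\sum_(n <oo) (t%:E * a n ^+ 2 + t^-1%:E * (b n ^+ 2)%:E))%E).
    apply: lee_nneseries => [n _ _|n _].
      by rewrite mule_ge0.
    have := a0 n; case: (a n) => [r r0|_|//].
      rewrite expe2 -!EFinM -EFinD lee_fin -subr_ge0.
      rewrite (_ : _ - _ = t * (r - b n / t) ^+ 2).
        by rewrite mulr_ge0 ?sqr_ge0// ltW.
      by field; rewrite gt_eqF.
    by rewrite expe2 mulyy (@gt0_muley _ t%:E)// addye ?leey.
  rewrite nneseriesD; last 2 first.
  - by move=> n _ _; rewrite mule_ge0// lee_fin ltW.
  - by move=> n _ _; rewrite mule_ge0 ?lee_fin ?sqr_ge0// ltW.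
  rewrite !nneseriesZl; [|by move=> *; rewrite lee_fin sqr_ge0|by []].
  by rewrite leeD2l// EFinM lee_wpmul2l// lee_fin ltW.
(* If S is infinite the right-hand side is too; otherwise t = 1 shows T
   finite. *)
move: T S T0 S0 amgm => T [s||//] T0 S0; last first.
  by move=> _; rewrite gt0_muley ?lte_fin// leey.
case: T T0 => [t t0|_|//]; last first.
  by move/(_ 1 ltr01); rewrite gt0_muley ?lte_fin.
move=> amgm; rewrite expe2 -!EFinM lee_fin.
have [->|tn0] := eqVneq t 0; first by rewrite mul0r mulr_ge0// ltW.
have tp : 0 < t by rewrite lt_def tn0.
(* The choice Q / t turns the bound into 2 t <= Q s / t + t. *)
have := amgm (Q / t) (divr_gt0 Q0 tp).
rewrite -!EFinM -EFinD lee_fin invf_div divfK ?gt_eqF// => h.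
have : t <= Q * s / t by move: h; rewrite mulrAC; lra.
by rewrite ler_pdivlMr.
Qed.

(** With a n the integral of g over the layer n, the left-hand side is the
    square of the sum of the b n * a n, and the iterated integral, restricted
    to pairs of points in a common layer, is the sum of the a n ^ 2. Leaving
    out the null diagonal makes room for kernels that are not bounded below
    there. *)
Lemma sqr_integral_le_layer_energy d (T : measurableType d) (R : realType)
    (mu : {measure set T -> \bar R}) (layer : T -> nat) (g : T -> R)
    (b : nat -> R) (Q : R) :
  (forall x : T, measurable [set x]) -> (forall x, mu [set x] = 0%E) ->
  measurable_fun [set: T] layer -> measurable_fun [set: T] g ->
  (forall x, 0 <= g x) -> (forall n, 0 <= b n) -> 0 < Q ->
  (\sum_(n <oo) (b n ^+ 2)%:E <= Q%:E)%E ->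
  ((\int[mu]_x (g x * b (layer x))%:E) ^+ 2 <=
   Q%:E * \int[mu]_x \int[mu]_(y in layer @^-1` [set layer x] `\ x)
     (g x * g y)%:E)%E.
Proof.
move=> mset1 set10 mlayer mg g0 b0 Q0 bQ.
pose D n := layer @^-1` [set n].
have mD n : measurable (D n) by rewrite -[D n]setTI; exact: mlayer.
have DT : \bigcup_n D n = setT.
  by apply/seteqP; split=> // x _; exists (layer x).
have tD : trivIset setT D by move=> i j _ _ [x [/= <- <-]].
have int_layers (f : T -> \bar R) :
    measurable_fun setT f -> (forall x, 0 <= f x)%E ->
    (\int[mu]_x f x = \sum_(n <oo) \int[mu]_(x in D n) f x)%E.
  by move=> mf f0; rewrite -DT; apply: ge0_integral_bigcup => //; rewrite DT.
have mgE A : measurable_fun A (EFin \o g).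
  by apply: measurable_funTS; exact/measurable_EFinP.
have gE0 x : (0 <= (g x)%:E)%E by rewrite lee_fin.
pose a n : \bar R := (\int[mu]_(x in D n) (g x)%:E)%E.
have a0 n : (0 <= a n)%E by apply: integral_ge0.
have -> : (\int[mu]_x (g x * b (layer x))%:E = \sum_(n <oo) (b n)%:E * a n)%E.
  rewrite int_layers; last 2 first.
  - apply/measurable_EFinP/measurable_funM => //.
    exact: (measurableT_comp (f := b)).
  - by move=> x; rewrite lee_fin mulr_ge0.
  apply: eq_eseriesr => n _; rewrite -ge0_integralZl_EFin//.
  by apply: eq_integral => x; rewrite inE => <-; rewrite -EFinM mulrC.
have -> : (\int[mu]_x \int[mu]_(y in layer @^-1` [set layer x] `\ x)
     (g x * g y)%:E = \sum_(n <oo) a n ^+ 2)%E.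
  (* The inner integral is g x times the mass of the layer of x. *)
  transitivity (\int[mu]_x ((g x)%:E * a (layer x)))%E.
    apply: eq_integral => x _; rewrite /a -ge0_integralZl_EFin//.
    rewrite [RHS](ge0_negligible_integral (mset1 x))//.
    - by apply: measurable_funeM.
    - by move=> y _; rewrite mule_ge0.
  rewrite int_layers; last 2 first.
  - apply: emeasurable_funM => //.
    exact: (measurableT_comp (f := a)).
  - by move=> x; rewrite mule_ge0.
  apply: eq_eseriesr => n _; rewrite expe2 -ge0_integralZr//.
  by apply: eq_integral => x; rewrite inE => <-.
exact: cauchy_schwarz_nneseries.
Qed.

(** The telescoping bound behind the convergence of Riemann sums with exponent
    1 + q: it is the mean value theorem for x^(-q), obtained here from exp s
    >= 1 + s and log (1 - s) <= - s. *)
Lemma powRN_succ_le (R : realType) (q x : R) : 0 < q -> 0 < x ->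
  (x + 1) `^ (- (1 + q)) <= q^-1 * (x `^ (- q) - (x + 1) `^ (- q)).
Proof.
move=> q0 x0; set y := x + 1.
have y0 : 0 < y by rewrite /y; lra.
rewrite -ler_pdivrMl ?invr_gt0// invrK.
rewrite opprD powRD; last by rewrite (gt_eqF y0) implybT.
rewrite powR_inv1 ?(ltW y0)//.
have yq0 := powR_gt0 (- q) y0.
have -> : x `^ (- q) = expR (q * (ln y - ln x)) * y `^ (- q).
  rewrite /powR !gt_eqF// -expRD; congr expR; ring.
have lnyx : y^-1 <= ln y - ln x.
  rewrite -opprB -ln_div ?posrE// lerNr.
  have -> : x / y = 1 + - y^-1 by rewrite /y; field; rewrite gt_eqF.
  by rewrite le_ln1Dx// ltrNl opprK invf_lt1// /y; lra.
have : 1 + q / y <= expR (q * (ln y - ln x)).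
  by apply: le_trans (expR_ge1Dx _); rewrite lerD2l ler_wpM2l// ltW.
rewrite mulrA; set e := expR _; set z := y `^ (- q) => h.
have -> : e * z - z = (e - 1) * z by ring.
by rewrite ler_wpM2r ?(ltW yq0)//; lra.
Qed.

Lemma sum_riemannR_le (R : realType) (q : R) (n : nat) : 0 < q ->
  \sum_(i < n.+1) riemannR (1 + q) i <= 1 + q^-1 * (1 - n.+1%:R `^ (- q)).
Proof.
move=> q0; elim: n => [|n IH].
  by rewrite big_ord_recl big_ord0 /riemannR/= !powR1 subrr mulr0 !addr0 invr1.
rewrite big_ord_recr/=.
have := @powRN_succ_le R q n.+1%:R q0 (ltr0Sn _ _).
rewrite natr1 (powRN _ (1 + q)) => h.
apply: le_trans (lerD IH h) _.
by rewrite -addrA -mulrDr addrA subrK.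
Qed.

(** The squares are, up to the factor 2^(2 alpha), the terms of the Riemann
    series of exponent 2 alpha = 1 + q; this is where alpha > 1/2 enters. *)
Lemma square_summable_powRN (R : realType) (alpha : R) : 1 / 2 < alpha ->
  exists2 Q : R, 0 < Q &
    (\sum_(n <oo) (((n.+1%:R / 2) `^ (- alpha)) ^+ 2)%:E <= Q%:E)%E.
Proof.
move=> alpha_gt; pose q := 2 * alpha - 1.
have q0 : 0 < q by rewrite /q; lra.
have qi0 : 0 < q^-1 by rewrite invr_gt0.
exists (2 `^ (2 * alpha) * (1 + q^-1)).
  by rewrite mulr_gt0 ?powR_gt0//; lra.
have sqE (n : nat) : ((n.+1%:R / 2) `^ (- alpha)) ^+ 2 =
    2 `^ (2 * alpha) * riemannR (1 + q) n :> R.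
  have n0 : 0 < n.+1%:R :> R by [].
  have d0 : 0 < n.+1%:R / 2 :> R by rewrite divr_gt0.
  have two0 : 0 < 2 :> R by [].
  rewrite -powR_mulrn ?powR_ge0// -powRrM /riemannR /powR.
  rewrite (gt_eqF d0) (gt_eqF n0) (gt_eqF two0).
  rewrite -expRN -expRD ln_div ?posrE// /q; congr expR; ring.
apply: lime_le.
  by apply: is_cvg_nneseries => n _ _; rewrite lee_fin sqr_ge0.
apply: nearW => n; rewrite sumEFin lee_fin.
under eq_bigr do rewrite sqE.
rewrite -mulr_sumr ler_wpM2l ?powR_ge0// big_mkord.
apply: (@le_trans _ _ (\sum_(i < n.+1) riemannR (1 + q) i)).
  by rewrite big_ord_recr/= lerDl invr_ge0 powR_ge0.
apply: le_trans (sum_riemannR_le R q n q0) _.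
by rewrite lerD2l -[leRHS]mulr1 ler_wpM2l ?(ltW qi0)// gerBl powR_ge0.
Qed.

(** * Logarithmic shells *)

(** The layers are numbered by natural numbers; this bijection orders the
    integers as 0, -1, 1, -2, 2, ..., since Negz m stands for - (m + 1). *)
Definition nat_of_int (k : int) : nat :=
  match k with Posz m => m.*2 | Negz m => m.*2.+1 end.

Definition int_of_nat (n : nat) : int :=
  if odd n then Negz n./2 else Posz n./2.

Lemma nat_of_intK : cancel nat_of_int int_of_nat.
Proof.
by case=> m; rewrite /int_of_nat/= odd_double/= ?doubleK// uphalf_double.
Qed.

Lemma int_of_natK : cancel int_of_nat nat_of_int.
Proof.
move=> n; rewrite /int_of_nat -[RHS]odd_double_half.
by case: (odd n).
Qed.

(** Compares the weight on a shell with the number of the shell. If t >= 0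
    then floor t = m is numbered 2 m with m <= |t|; if t < 0 then floor t = -
    (m + 1) is numbered 2 m + 1 with m < |t|. *)
Lemma nat_of_int_floor_le (R : realType) (t : R) :
  (nat_of_int (Num.floor t)).+1%:R / 2 <= 1 + `|t|.
Proof.
have /andP[] := floor_itv t; case: (Num.floor t) => m /=.
  rewrite -pmulrn => mt _; have := ler_norm t.
  rewrite -addn1 -muln2 natrD natrM; lra.
rewrite NegzE => _; rewrite -addn1 PoszD opprD addrNK mulrNz -pmulrn => tm.
have := ler_norm (- t); rewrite normrN => tn.
by rewrite -addn1 -[m.*2.+1]addn1 -muln2 !natrD natrM; lra.
Qed.

Lemma same_floor_ln_le (R : realType) (r s : R) : 0 < r -> 0 < s ->
  Num.floor (ln r) = Num.floor (ln s) -> r <= expR 1 * s.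
Proof.
move=> r0 s0 rs.
rewrite -ler_ln ?posrE ?mulr_gt0 ?expR_gt0// lnM ?posrE ?expR_gt0// expRK.
have /andP[+ _] := floor_itv (ln s); have /andP[_] := floor_itv (ln r).
rewrite rs intrD => h1 h2; apply: ltW.
by apply: lt_le_trans h1 _; rewrite addrC lerD2l.
Qed.

Section euclidean_norm.
Context {R : realType} {n : nat}.
Implicit Types x y : 'rV[R]_n.

Lemma enorm_ge0 x : 0 <= enorm x.
Proof. exact: sqrtr_ge0. Qed.

Lemma sqr_enorm x : enorm x ^+ 2 = \sum_(i < n) x ord0 i ^+ 2.
Proof. by rewrite sqr_sqrtr// sumr_ge0// => i _; exact: sqr_ge0. Qed.

Lemma enorm_gt0 x : x != 0 -> 0 < enorm x.
Proof.
move=> x0; rewrite lt_def enorm_ge0 andbT; apply: contraNneq x0 => nx0.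
have := sqr_enorm x; rewrite nx0 expr0n/= => /esym/eqP.
rewrite psumr_eq0 => [/allP h|i _]; last exact: sqr_ge0.
apply/eqP/rowP => i; apply/eqP; rewrite mxE -sqrf_eq0.
exact: (h i (mem_index_enum i)).
Qed.

(** The defect is |x + y|^2. *)
Lemma sqr_enormB_le x y :
  enorm (x - y) ^+ 2 <= 2 * (enorm x ^+ 2 + enorm y ^+ 2).
Proof.
rewrite !sqr_enorm -big_split/= mulr_sumr; apply: ler_sum => i _.
rewrite !mxE -subr_ge0.
by rewrite (_ : _ - _ = (x ord0 i + y ord0 i) ^+ 2) ?sqr_ge0//; ring.
Qed.

Lemma measurable_enorm : measurable_fun [set: 'rV[R]_n] enorm.
Proof.
apply: (@measurableT_comp _ _ _ _ _ _ (@Num.sqrt R)).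
  by apply: continuous_measurable_fun; exact: sqrt_continuous.
apply: measurable_sum => i; apply: measurable_funX; exact: measurable_rV_coord.
Qed.

(** Since ln 0 = 0, the origin lies in the shell 0; it carries no mass. *)
Definition log_shell x : nat := nat_of_int (Num.floor (ln (enorm x))).

Lemma measurable_log_shell : measurable_fun [set: 'rV[R]_n] log_shell.
Proof.
have mln : measurable_fun [set: 'rV[R]_n] (@ln R \o enorm).
  by apply: measurableT_comp; [exact: measurable_ln|exact: measurable_enorm].
move=> _ Y _; rewrite setTI.
rewrite (_ : _ @^-1` _ = \bigcup_(k in Y)
    ((@ln R \o enorm) @^-1`
      `[(int_of_nat k)%:~R, (int_of_nat k + 1)%:~R[%classic)).
  apply: bigcup_measurable => k _; rewrite -[X in measurable X]setTI.
  exact: mln.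
have floorE k x : log_shell x = k <->
    (ln (enorm x) \in `[(int_of_nat k)%:~R, (int_of_nat k + 1)%:~R[).
  rewrite in_itv/= -floor_eq; split=> [<-|/eqP fk].
    by rewrite nat_of_intK.
  by rewrite /log_shell fk int_of_natK.
apply/seteqP; split=> x /=.
  by move=> Yx; exists (log_shell x) => //=; exact/floorE.
by move=> [k Yk /= /floorE ->].
Qed.

(** On a common shell each norm is at most e times the other, so that both
    squared norms are at most e |x| |y|. *)
Lemma enormB_log_shell_le (p : R) x y : 0 <= p -> 0 < enorm x -> 0 < enorm y ->
  log_shell x = log_shell y ->
  enorm (x - y) `^ (2 * p) <=
    (4 * expR 1) `^ p * (enorm x `^ p * enorm y `^ p).
Proof.
move=> p0 x0 y0 /(can_inj nat_of_intK) xy.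
have xy1 := same_floor_ln_le _ _ _ x0 y0 xy.
have yx1 := same_floor_ln_le _ _ _ y0 x0 (esym xy).
rewrite powRrM powR_mulrn ?enorm_ge0// -!powRM ?mulr_ge0 ?expR_ge0 ?enorm_ge0//.
rewrite ge0_ler_powR ?nnegrE ?sqr_ge0 ?mulr_ge0 ?expR_ge0 ?enorm_ge0//.
apply: le_trans (sqr_enormB_le x y) _.
have h1 : enorm x ^+ 2 <= expR 1 * (enorm x * enorm y).
  by rewrite expr2 mulrCA ler_wpM2l// enorm_ge0.
have h2 : enorm y ^+ 2 <= expR 1 * (enorm x * enorm y).
  by rewrite expr2 mulrA ler_wpM2r// enorm_ge0.
rewrite -mulrA; lra.
Qed.

End euclidean_norm.

(** * Points are null sets *)

Section lebesgue_points.
Context {R : realType} {n : nat}.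

Lemma measurable_set1_rV (x : 'rV[R]_n) : measurable [set x].
Proof.
rewrite (_ : [set x] = \bigcap_(i in [set: 'I_n])
    (setT `&` rV_coord i @^-1` [set x ord0 i])).
  by apply: fin_bigcap_measurable => // i _; exact: measurable_rV_coord.
apply/seteqP; split=> y /=; first by move=> -> i _.
by move=> h; apply/rowP => i; have [] := h i I.
Qed.

Lemma lebesgue_rV_set1 (x : 'rV[R]_n) :
  (0 < n)%N -> lebesgue_rV n [set x] = 0%E.
Proof.
move=> n0.
rewrite (_ : [set x] = [set y | forall i, [set x ord0 i] (y ord0 i)]).
  rewrite (@lebesgue_rV_box R n (fun i => [set x ord0 i]))//.
  rewrite (bigD1 (Ordinal n0))//=.
  by rewrite lebesgue_measure_set1 mul0e.
apply/seteqP; split=> y /=; first by move=> ->.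
by move=> h; apply/rowP => i; rewrite h.
Qed.

End lebesgue_points.

(** * The Coulomb energy and the weighted norm *)

(** The layer inequality applied to g = u^2 / (K |x|^p) and to the weights K
    ((n + 1) / 2)^(-alpha), where K^2 = (4 e)^p: dividing g by K absorbs the
    constant of the kernel bound, and multiplying the weights by K leaves the
    left-hand side unchanged. *)
Lemma coulomb_energy_ge (R : realType) (N : nat) (alpha : R) :
  (3 <= N)%N -> 1 / 2 < alpha ->
  exists2 c : R, 0 < c &
    forall u : 'rV[R]_N -> R, ae_borel (lebesgue_rV N) u ->
      (c%:E * (\int[lebesgue_rV N]_x
         (u x ^+ 2 / (enorm x `^ ((N%:R - 2) / 2) *
                      (1 + `|ln (enorm x)|) `^ alpha))%:E) ^+ 2 <=
       \int[lebesgue_rV N]_x \int[lebesgue_rV N]_y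
         (u x ^+ 2 * u y ^+ 2 / enorm (x - y) ^+ (N - 2))%:E)%E.
Proof.
move=> N3 alpha_gt; set mu := lebesgue_rV N; set p := (N%:R - 2) / 2.
have [Q Q0 bQ] := square_summable_powRN R alpha alpha_gt.
have p0 : 0 < p.
  by rewrite divr_gt0// subr_gt0 ltr_nat.
have p2 : 2 * p = (N - 2)%:R.
  rewrite natrB; last exact: ltnW.
  by rewrite /p; field.
pose M : R := (4 * expR 1) `^ p.
have M0 : 0 < M by rewrite powR_gt0// mulr_gt0 ?expR_gt0.
pose K := Num.sqrt M.
have K0 : 0 < K by rewrite sqrtr_gt0.
have KM : K ^+ 2 = M by rewrite sqr_sqrtr// ltW.
pose b n : R := K * (n.+1%:R / 2) `^ (- alpha).
have b0 n : 0 <= b n by rewrite mulr_ge0 ?powR_ge0// ltW.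
have MQ0 : 0 < M * Q by rewrite mulr_gt0.
have bMQ : (\sum_(n <oo) (b n ^+ 2)%:E <= (M * Q)%:E)%E.
  under eq_eseriesr do rewrite exprMn KM EFinM.
  rewrite nneseriesZl; last by move=> n _; rewrite lee_fin sqr_ge0.
  by rewrite EFinM lee_wpmul2l// lee_fin ltW.
exists (M * Q)^-1; first by rewrite invr_gt0.
move=> u [A [v [mA A0 mv uv]]].
have mus1 x : mu [set x] = 0%E by apply: lebesgue_rV_set1; exact: leq_trans N3.
pose g0 x := K^-1 * (v x ^+ 2 / enorm x `^ p).
(* The function g is put to 0 on A, and so bounds the energy density from
   below. *)
pose g := g0 \_ (~` A).
have g0_ge0 x : 0 <= g0 x.
  by rewrite mulr_ge0 ?invr_ge0 ?(ltW K0)// divr_ge0 ?sqr_ge0 ?powR_ge0.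
have g_ge0 x : 0 <= g x by rewrite /g patchE; case: ifP.
have mg : measurable_fun [set: 'rV[R]_N] g.
  apply/(measurable_restrictT _ _).1; first exact: measurableC.
  apply: measurable_funTS; apply: measurable_funM => //.
  apply: measurable_funM; first exact: measurable_funX.
  under eq_fun do rewrite -powRN.
  apply: (measurableT_comp (f := fun r : R => r `^ (- p))).
    exact: measurable_powR.
  exact: measurable_enorm.
have energy := @sqr_integral_le_layer_energy _ _ _ mu log_shell g b (M * Q)
  measurable_set1_rV mus1 measurable_log_shell mg g_ge0 b0 MQ0 bMQ.
set X := (\int[mu]_x _)%E in energy.
set E := (\int[mu]_x _)%E in energy.
have XY : (\int[mu]_x
    (u x ^+ 2 / (enorm x `^ p * (1 + `|ln (enorm x)|) `^ alpha))%:E <= X)%E.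
  (* On A nothing is known about u: the majorant is infinite there. *)
  pose oo_A : 'rV[R]_N -> \bar R := (cst +oo%E) \_ A.
  have moo : measurable_fun setT oo_A.
    exact: (measurable_restrictT (cst +oo%E) mA).1 (measurable_cst _).
  have oo_ge0 x : (0 <= oo_A x)%E.
    by apply: erestrict_ge0 => y _; exact: leey.
  have mgb : measurable_fun setT (fun x => (g x * b (log_shell x))%:E).
    apply/measurable_EFinP/measurable_funM => //.
    by apply: (measurableT_comp (f := b)) => //; exact: measurable_log_shell.
  have gb_ge0 x : (0 <= (g x * b (log_shell x))%:E)%E.
    by rewrite lee_fin mulr_ge0.
  have -> : X = (\int[mu]_x ((g x * b (log_shell x))%:E + oo_A x))%E.
    have oo_int : (\int[mu]_x oo_A x = 0)%E.
      rewrite /oo_A -(integral_mkcond A (cst +oo%E)).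
      transitivity (+oo * mu A)%E; first exact: integral_cst.
      by rewrite A0 mule0.
    by rewrite ge0_integralD// oo_int adde0.
  apply: ge0_le_lower_integral => x.
    by rewrite lee_fin divr_ge0 ?sqr_ge0// mulr_ge0 ?powR_ge0.
  rewrite /oo_A /g !patchE; have [Ax|nAx] := pselect (A x).
    by rewrite (mem_set Ax) addey ?leey.
  rewrite (mem_set (nAx : (~` A) x)) memNset// adde0 lee_fin uv//.
  rewrite /g0 /b mulrACA mulVf ?gt_eqF// mul1r invfM mulrA ler_wpM2l//.
    by rewrite divr_ge0 ?sqr_ge0 ?powR_ge0.
  have shell0 : 0 < (log_shell x).+1%:R / 2 :> R by rewrite divr_gt0.
  have log0 : 0 < 1 + `|ln (enorm x)| by rewrite ltr_pwDl.
  rewrite powRN lef_pV2 ?posrE ?powR_gt0//.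
  rewrite ge0_ler_powR ?nnegrE ?(ltW shell0) ?(ltW log0)//.
    by apply: ltW; apply: lt_trans alpha_gt; rewrite divr_gt0.
  exact: nat_of_int_floor_le.
have EZ : (E <= \int[mu]_x \int[mu]_y
    (u x ^+ 2 * u y ^+ 2 / enorm (x - y) ^+ (N - 2))%:E)%E.
  apply: ge0_le_lower_integral => x.
    by apply: integral_ge0 => y _; rewrite lee_fin mulr_ge0.
  rewrite integral_mkcond; apply: ge0_le_lower_integral => y.
    by rewrite patchE; case: ifP => // _; rewrite lee_fin mulr_ge0.
  have K_ge0 z w : 0 <= u z ^+ 2 * u w ^+ 2 / enorm (z - w) ^+ (N - 2).
    by rewrite divr_ge0 ?exprn_ge0 ?enorm_ge0// mulr_ge0 ?sqr_ge0.
  rewrite patchE; case: ifPn => [|_]; last by rewrite lee_fin.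
  rewrite inE => -[/= xy ynx]; rewrite lee_fin /g !patchE.
  case: ifPn => [/set_mem nAx|_]; last by rewrite /point/= mul0r.
  case: ifPn => [/set_mem nAy|_]; last by rewrite /point/= mulr0.
  rewrite !uv// /g0.
  (* At the origin |x|^p = 0, whose inverse is 0, so g vanishes there. *)
  have := enorm_ge0 x; rewrite le_eqVlt => /predU1P[<-|x0].
    by rewrite powR0 ?gt_eqF// invr0 !mulr0 mul0r -!uv.
  have := enorm_ge0 y; rewrite le_eqVlt => /predU1P[<-|y0].
    by rewrite powR0 ?gt_eqF// invr0 !mulr0 -!uv.
  have xy0 : 0 < enorm (x - y).
    by apply: enorm_gt0; rewrite subr_eq0; apply/eqP => xy'; apply: ynx.
  have := @enormB_log_shell_le _ _ p x y (ltW p0) x0 y0 (esym xy).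
  rewrite p2 powR_mulrn ?enorm_ge0// -/M => kernel.
  rewrite [leLHS](_ : _ = v x ^+ 2 * v y ^+ 2 /
      (M * (enorm x `^ p * enorm y `^ p))).
    rewrite ler_wpM2l//; first by apply: mulr_ge0; exact: sqr_ge0.
    by rewrite lef_pV2 ?posrE ?exprn_gt0 ?mulr_gt0 ?powR_gt0.
  by rewrite -KM; field; rewrite !gt_eqF ?powR_gt0.
set Y := (\int[mu]_x _)%E in XY *.
set Z := (\int[mu]_x _)%E in EZ *.
have Y0 : (0 <= Y)%E.
  apply: integral_ge0 => x _.
  by rewrite lee_fin divr_ge0 ?sqr_ge0// mulr_ge0 ?powR_ge0.
have YZ : (Y ^+ 2 <= (M * Q)%:E * Z)%E.
  apply: (@le_trans _ _ (X ^+ 2)%E); first by rewrite !expe2 lee_pmul.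
  by apply: le_trans energy _; rewrite lee_wpmul2l// lee_fin ltW.
apply: (@le_trans _ _ (((M * Q)^-1)%:E * ((M * Q)%:E * Z))%E).
  by rewrite lee_wpmul2l// lee_fin invr_ge0 ltW.
by rewrite muleA -EFinM mulVf ?mul1e// gt_eqF.
Qed.

Lemma poweR12_sqr (R : realType) (x : \bar R) :
  (0 <= x)%E -> ((x ^+ 2) `^ 2^-1 = x)%E.
Proof.
move: x => [r r0|_|//]; last first.
  by rewrite expe2 mulyy poweRyr// gt_eqF// invr_gt0.
rewrite -EFin_expe poweR_EFin powR12_sqrt ?sqr_ge0//.
by rewrite sqrtr_sqr ger0_norm.
Qed.

(** With I the weighted integral of u^2, the energy inequality c I^2 <=
    coulomb u gives I <= c^(-1/2) (coulomb u)^(1/2), and this last root is a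
    summand of the squared norm in E. Asking only for a Borel version of u
    makes the bound apply to differences. *)
Lemma weighted_L2norm_le_E_norm (R : realType) (alpha : R) : 1 / 2 < alpha ->
  let w (x : 'rV[R]_3) :=
    enorm x `^ (- (1 / 2)) * (1 + `|ln (enorm x)|) `^ (- alpha) in
  exists2 C : R, 0 < C & forall u, ae_borel (lebesgue_rV 3) u ->
    (weighted_L2norm w u <= C%:E * E_norm u)%E /\
    (coulomb u < +oo -> weighted_L2norm w u < +oo)%E.
Proof.
move=> alpha_gt w.
have [c c0 ineq] := coulomb_energy_ge R 3 alpha isT alpha_gt.
pose C := c `^ (- 2^-1); have C0 : 0 < C by exact: powR_gt0.
exists (C `^ 2^-1); first exact: powR_gt0.
move=> u /ineq; rewrite /weighted_L2norm.
have -> : (\int[lebesgue_rV 3]_x (u x ^+ 2 /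
    (enorm x `^ ((3%:R - 2) / 2) * (1 + `|ln (enorm x)|) `^ alpha))%:E =
    \int[lebesgue_rV 3]_x (u x ^+ 2 * w x)%:E)%E.
  apply: eq_integral => x _; rewrite /w !powRN invfM.
  by rewrite (_ : 3%:R - 2 = 1 :> R)//; ring.
set I := (\int[lebesgue_rV 3]_x _)%E => cI.
have I0 : (0 <= I)%E.
  apply: integral_ge0 => x _.
  by rewrite lee_fin mulr_ge0 ?sqr_ge0// mulr_ge0 ?powR_ge0.
have V0 : (0 <= coulomb u)%E.
  apply: integral_ge0 => x _; apply: integral_ge0 => y _.
  by rewrite lee_fin divr_ge0 ?enorm_ge0// mulr_ge0 ?sqr_ge0.
have {}cI : (c%:E * I ^+ 2 <= coulomb u)%E.
  by apply: le_trans cI _; rewrite le_eqVlt; apply/orP; left; apply/eqP.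
have I20 : (0 <= I ^+ 2)%E by rewrite expe2 mule_ge0.
have cI2 : ((c `^ 2^-1)%:E * I <= coulomb u `^ 2^-1)%E.
  rewrite -poweR_EFin -[in leLHS](poweR12_sqr _ I I0) -poweRM//; last first.
    by rewrite lee_fin ltW.
  apply: gt0_ler_poweR => //; rewrite in_itv/= leey andbT//.
  by rewrite mule_ge0// lee_fin ltW.
split; last first.
  move=> Voo; apply: poweR_lty; rewrite ltey; apply/eqP => Ioo.
  move: cI; rewrite Ioo expe2 mulyy gt0_muley ?lte_fin// leye_eq => /eqP Ve.
  by rewrite Ve in Voo.
rewrite /E_norm; set G := (\int[_]_x _)%E.
have G0 : (0 <= G)%E by apply: integral_ge0 => x _; rewrite lee_fin sqr_ge0.
rewrite -poweR_EFin.
rewrite -poweRM; [|by rewrite lee_fin ltW|by rewrite adde_ge0 ?poweR_ge0].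
apply: gt0_ler_poweR => //; rewrite ?in_itv/= ?leey ?andbT//.
  by rewrite mule_ge0 ?lee_fin ?(ltW C0)// adde_ge0 ?poweR_ge0.
apply: (@le_trans _ _ (C%:E * coulomb u `^ 2^-1)%E); last first.
  by rewrite lee_wpmul2l ?lee_fin ?(ltW C0)// leeDr.
apply: (@le_trans _ _ (C%:E * ((c `^ 2^-1)%:E * I))%E); last first.
  by rewrite lee_wpmul2l ?lee_fin ?(ltW C0).
by rewrite muleA -EFinM /C powRN mulVf ?mul1e// gt_eqF// powR_gt0.
Qed.

Theorem theorem1p1 (R : realType) :
  (forall N : nat, (3 <= N)%N -> forall alpha : R, 1 / 2 < alpha ->
    exists2 c : R, 0 < c &
      forall u : 'rV[R]_N -> R, lebesgue_measurable u ->
        (\int[@lebesgue_rV R N]_x \int[@lebesgue_rV R N]_y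
           (u x ^+ 2 * u y ^+ 2 / enorm (x - y) ^+ (N - 2))%:E
         >= c%:E *
            (\int[@lebesgue_rV R N]_x
               (u x ^+ 2 / (enorm x `^ ((N%:R - 2) / 2) *
                            (1 + `|ln (enorm x)|) `^ alpha))%:E) ^+ 2)%E)
  /\
  (forall alpha : R, 1 / 2 < alpha ->
    let w (x : 'rV[R]_3) :=
      enorm x `^ (- (1 / 2)) * (1 + `|ln (enorm x)|) `^ (- alpha) in
    continuous_inclusion (@E_space R) (@E_norm R)
      (weighted_L2 w) (weighted_L2norm w)).
Proof.
split=> [N N3 alpha alpha_gt|alpha alpha_gt w].
  have [c c0 ineq] := coulomb_energy_ge R N alpha N3 alpha_gt.
  by exists c => // u /completion_measurable_ae_borel/ineq.
have [C C0 NC] := weighted_L2norm_le_E_norm R alpha alpha_gt.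
have borel (u : 'rV[R]_3 -> R) : E_space u -> ae_borel (lebesgue_rV 3) u.
  by move=> [[mu_u _ _ _] _]; exact: completion_measurable_ae_borel.
split.
- move=> u Eu; have [_ fin] := NC u (borel u Eu).
  by case: Eu => [[mu_u _ _ _] Vu]; split=> //; exact: fin.
- move=> u Eu eps eps0; exists (eps / C); first by rewrite divr_gt0.
  move=> v Ev vu.
  have [NCvu _] := NC _ (ae_borelB _ _ _ _ _ _ (borel v Ev) (borel u Eu)).
  apply: le_lt_trans NCvu _.
  by rewrite -(divfK (lt0r_neq0 C0) eps) mulrC EFinM lte_pmul2l// lte_fin.
- by exists C => // u /borel/NC[].
Qed.
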